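(* Let $s \ge 0$, $k \ge \ell \ge s+1$ and $n \ge k+\ell$ be integers. Let $\mathcal{F} \subseteq \binom{[n]}{k}$ and $\mathcal{G} \subseteq \binom{[n]}{\ell}$ be cross-intersecting families. Suppose that $\mathcal{G}$ is intersecting and $\binom{[\ell+s]}{\ell} \subseteq \mathcal{G}$. Then $$|\mathcal{F}|+|\mathcal{G}| \le \binom{\ell+s}{\ell}+\binom{n}{k}-\sum_{i=0}^{s}\binom{\ell+s}{i}\binom{n-\ell-s}{k-i}.$$
   Context: $[n]=\{1,2,\ldots,n\}$, and for a set $X$, $\binom{X}{k}$ denotes the family of all $k$-element subsets of $X$. Two families $\mathcal{F},\mathcal{G}\subseteq 2^{[n]}$ are cross-intersecting if $|F\cap G|\ge 1$ for all $F\in\mathcal{F}$ and $G\in\mathcal{G}$. A family $\mathcal{G}\subseteq 2^{[n]}$ is intersecting if $|G\cap G'|\ge 1$ for all $G,G'\in\mathcal{G}$. A binomial coefficient $\binom{a}{b}$ with integers $0\le a<b$ is $0$. *)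

(* Defs.v *)
From mathcomp Require Import all_boot all_order all_algebra.

Set Implicit Arguments.
Unset Strict Implicit.
Unset Printing Implicit Defensive.

(* The ground set [n] = {1, ..., n} is rendered by 'I_n = {0, ..., n - 1}, so
   the initial segment [m] of [n] consists of the i : 'I_n with i < m. *)
Definition initseg (n m : nat) : {set 'I_n} := [set i : 'I_n | i < m].

Definition ksubsets (T : finType) (X : {set T}) (k : nat) : {set {set T}} :=
  [set A : {set T} | (A \subset X) && (#|A| == k)].

Definition cross_intersecting (T : finType) (F G : {set {set T}}) : Prop :=
  forall A B : {set T}, A \in F -> B \in G -> 1 <= #|A :&: B|.

(* A and B are not required to be distinct. *)
Definition intersecting (T : finType) (G : {set {set T}}) : Prop :=
  forall A B : {set T}, A \in G -> B \in G -> 1 <= #|A :&: B|.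

(* Main.v *)
(** Write X for the initial segment of size l + s.  Every member of F and of G
    meets all l-subsets of X, hence meets X in more than s points, and the
    members B of G other than the l-subsets of X satisfy
    s < |B :&: X| < l.  The poset P of all sets A with s < |A :&: X| < l is a
    product of the middle levels of a Boolean lattice with a Boolean lattice, so
    it has a symmetric chain decomposition.  As l <= k <= n - l, walking down the
    chains injects level n - l of P into level k of P; applied to the complement
    of B it gives a k-set which is disjoint from B, hence not in F, and still
    meets X in more than s points.  So F together with |G| - 'C(l + s, l) such
    sets fits into the family of k-sets meeting X in more than s points. *)

Require Import Defs.
From mathcomp Require Import all_boot all_order all_algebra.
From mathcomp Require Import zify.

Set Implicit Arguments.
Unset Strict Implicit.
Unset Printing Implicit Defensive.

(** * Symmetric chain decompositions of set families *)

Section SetFamilies.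

Variable T : finType.
Implicit Types (D : {set {set T}}) (A B X : {set T}) (v : T).

(* A decomposition of [D] into chains that are symmetric about rank [N / 2]:
   the chain through [A] has ranks [lo A], ..., [N - lo A], and [g A r] is its
   member of rank [r]. *)
Definition symmetric_chains D (N : nat) (lo : {set T} -> nat)
    (g : {set T} -> nat -> {set T}) : Prop :=
  forall A, A \in D ->
    [/\ lo A <= #|A|, #|A| + lo A <= N, g A #|A| = A
      & forall r, lo A <= r -> r + lo A <= N ->
        [/\ g A r \in D, #|g A r| = r, lo (g A r) = lo A, g (g A r) =1 g A
          & forall q, r <= q -> q + lo A <= N -> g A r \subset g A q]].

Definition has_symmetric_chains D N :=
  exists lo g, symmetric_chains D N lo g.

Lemma has_symmetric_chains_set0 : has_symmetric_chains [set set0] 0.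
Proof.
exists (fun=> 0), (fun _ _ => set0) => A /set1P->.
rewrite cards0; split=> // r _; rewrite addn0 leqn0 => /eqP->.
by rewrite inE eqxx; split.
Qed.

(** Cutting each chain to the ranks from [m] to [N - m] keeps it symmetric; its new lowest rank is
    the larger of [lo A] and [m]. *)
Lemma has_symmetric_chains_middle D N m :
  has_symmetric_chains D N ->
  has_symmetric_chains [set A in D | m <= #|A| & #|A| + m <= N] N.
Proof.
move=> [lo [g Dg]]; exists (fun A => maxn (lo A) m), g => A.
rewrite inE => /and3P[/Dg[loA Alo gA gP] mA Am].
split=> // [||r]; [lia | lia | move=> lo_r r_lo].
have [||grD gr_r lo_gr ggr gr_sub] := gP r; [lia | lia |].
split=> //; first by rewrite inE grD gr_r; lia.
  by rewrite lo_gr.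
by move=> q rq q_lo; apply: gr_sub => //; lia.
Qed.

(* The step of de Bruijn, Tengbergen and Kruyswijk: a chain C1, ..., Cm is
   replaced by C1, ..., Cm, v |: Cm and v |: C1, ..., v |: C(m-1).
   [short A] says that [A] is in a chain of the second kind. *)
Lemma has_symmetric_chains_add D N v :
  (forall A, A \in D -> v \notin A) -> has_symmetric_chains D N ->
  has_symmetric_chains [set A | A :\ v \in D] N.+1.
Proof.
move=> Dv [lo [g Dg]].
pose short A := (v \in A) && (#|A :\ v| + lo (A :\ v) != N).
(* On a chain of the first kind, the [else] branch serves only the new top rank [N.+1 - lo]. A chain
   of the second kind loses its old top and gains [v], so it starts one rank higher. *)
pose g' A r := if ~~ short A && (r + lo (A :\ v) <= N) then g (A :\ v) r
               else v |: g (A :\ v) r.-1.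
exists (fun A => lo (A :\ v) + short A), g' => A; rewrite inE => AD.
have [loA Alo gA gP] := Dg _ AD.
have cA : #|A| = (v \in A) + #|A :\ v| by rewrite (cardsD1 v).
have gK r : lo (A :\ v) <= r -> r + lo (A :\ v) <= N ->
    (g (A :\ v) r :\ v = g (A :\ v) r) /\
    ((v |: g (A :\ v) r) :\ v = g (A :\ v) r).
  move=> h1 h2; have [/Dv vr _ _ _ _] := gP r h1 h2.
  split; last by rewrite setU1K.
  by apply/setDidPl; rewrite disjoint_sym disjoints1.
have vg r : lo (A :\ v) <= r -> r + lo (A :\ v) <= N -> v \notin g (A :\ v) r.
  by move=> h1 h2; have [/Dv] := gP r h1 h2.
split.
- by rewrite cA /short; case: (v \in A) => /=; lia.
- by rewrite cA /short; case: (v \in A) => /=; lia.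
- rewrite /g' cA /short; case: (boolP (v \in A)) => vA /=.
    rewrite add1n /=; case: eqP => e /=; last by rewrite gA setD1K.
    by rewrite ifN ?gA ?setD1K //; lia.
  rewrite add0n Alo gA; apply/setDidPl; rewrite disjoint_sym disjoints1 //.
move=> r.
case sA: (short A); rewrite ?addn1 ?addn0 => lo_r r_lo.
  have h1 : lo (A :\ v) <= r.-1 by lia.
  have h2 : r.-1 + lo (A :\ v) < N by lia.
  have [gD gc gl gg gs] := gP _ h1 (ltnW h2).
  have g'E q : g' A q = v |: g (A :\ v) q.-1 by rewrite /g' sA.
  have [_ eK] := gK _ h1 (ltnW h2).
  have s' : short (g' A r).
    by rewrite /short g'E eK setU11 /= gl gc; lia.
  split.
  - by rewrite inE g'E eK.
  - by rewrite g'E cardsU1 vg ?gc; lia.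
  - by rewrite s' g'E eK gl addn1.
  - by move=> q; rewrite {1}/g' s' /= g'E eK gg.
  - by move=> q rq q_lo; rewrite !g'E setUS // gs; lia.
have g'E q : g' A q = if q + lo (A :\ v) <= N then g (A :\ v) q
               else v |: g (A :\ v) q.-1 by rewrite /g' sA.
(* [r0] is the rank of [g' A r :\ v] in the old chain: [r.-1] at the new top, [r] elsewhere. *)
have [r0 [h1 h2 e]] : exists r0, [/\ lo (A :\ v) <= r0, r0 + lo (A :\ v) <= N &
   g' A r :\ v = g (A :\ v) r0 /\ ~~ short (g' A r)].
  rewrite g'E; case: leqP => h.
    exists r; split=> //; have [e1 _] := gK _ lo_r h; split=> //.
    by rewrite /short (negbTE (vg _ lo_r h)).
  have h1 : lo (A :\ v) <= r.-1 by lia.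
  have h2 : r.-1 + lo (A :\ v) <= N by lia.
  exists r.-1; split=> //; have [_ e1] := gK _ h1 h2; split=> //.
  have [_ gc gl _ _] := gP _ h1 h2.
  by rewrite /short e1 gc gl; lia.
case: e => e /negbTE s'.
have [gD gc gl gg gs] := gP _ h1 h2.
split.
- by rewrite inE e.
- rewrite g'E; case: leqP => h; first by have [] := gP _ lo_r h.
  have k1 : lo (A :\ v) <= r.-1 by lia.
  have k2 : r.-1 + lo (A :\ v) <= N by lia.
  by rewrite cardsU1 vg //; have [_ -> _ _ _] := gP _ k1 k2; lia.
- by rewrite s' e gl addn0.
- by move=> q; rewrite {1}/g' s' /= e gl !gg g'E.
- move=> q rq q_lo; rewrite !g'E; case: (leqP (r + _)) => hr.
    have [_ _ _ _ gs'] := gP _ lo_r hr.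
    case: leqP => hq; first exact: gs'.
    have [/eqP|rq'] := boolP (r == q); first by lia.
    by apply: subset_trans (gs' q.-1 _ _) (subsetUr _ _); lia.
  have -> : q = r by lia.
  by rewrite leqNgt hr.
Qed.

(** The points of [X] are added one at a time, each raising the rank sum by one. *)
Lemma has_symmetric_chains_extend D N X :
  (forall A, A \in D -> [disjoint A & X]) -> has_symmetric_chains D N ->
  has_symmetric_chains [set A | A :\: X \in D] (N + #|X|).
Proof.
elim: {X}#|X| {-2}X (erefl #|X|) D N => [|m IH] X.
  move=> /eqP; rewrite cards_eq0 => /eqP-> D N _; rewrite cards0 addn0.
  by rewrite (_ : finset _ = D) //; apply/setP=> A; rewrite inE setD0.
move=> cX D N DX Dg.
have /card_gt0P[v vX] : 0 < #|X| by rewrite cX.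
have cX' : #|X :\ v| = m by move: cX; rewrite (cardsD1 v) vX; case.
have -> : [set A | A :\: X \in D]
        = [set A | A :\: (X :\ v) \in [set A | A :\ v \in D]].
  by apply/setP=> A; rewrite !inE setDDl setUC setD1K.
rewrite cX -addSnnS -cX'; apply: IH => //.
  move=> A; rewrite inE => /DX; rewrite -!setI_eq0 => /eqP/setP h.
  by apply/eqP/setP=> x; move: (h x); rewrite !inE; case: (x == v); rewrite ?andbF.
apply: has_symmetric_chains_add => // A /DX.
by rewrite disjoint_sym => /disjointFr->.
Qed.

(** Start from the empty set alone, add the points of [X], trim to the middle ranks, then add the
    points outside [X]. *)
Lemma has_symmetric_chains_band X m :
  has_symmetric_chains
    [set A | m <= #|A :&: X| & #|A :&: X| + m <= #|X|] #|T|.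
Proof.
have powX : has_symmetric_chains (powerset X) #|X|.
  have := has_symmetric_chains_extend (X := X) _ has_symmetric_chains_set0.
  rewrite add0n; have -> : [set A | A :\: X \in [set set0]] = powerset X.
    by apply/setP=> A; rewrite !inE setD_eq0.
  by apply=> A /set1P->; rewrite -setI_eq0 set0I.
have := has_symmetric_chains_extend (X := ~: X) _ (has_symmetric_chains_middle m powX).
rewrite cardsC.
have -> : [set A | A :\: ~: X \in
   [set B in powerset X | m <= #|B| & #|B| + m <= #|X|]]
   = [set A | m <= #|A :&: X| & #|A :&: X| + m <= #|X|].
  by apply/setP=> A; rewrite !inE setDE setCK subsetIr.
by apply=> A; rewrite !inE disjoints_subset setCK => /andP[].
Qed.

(** The chain through a set of rank [h] has lowest rank at most [N - h <= k], so it reaches rank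
    [k]. The image determines the chain, whose member of rank [h] is the original set. *)
Lemma symmetric_chains_inj D N h k :
  k <= h -> N <= h + k -> has_symmetric_chains D N ->
  exists phi : {set T} -> {set T},
    {in [set A in D | #|A| == h] &, injective phi} /\
    {in [set A in D | #|A| == h], forall A,
       [/\ phi A \in D, #|phi A| = k & phi A \subset A]}.
Proof.
move=> kh Nhk [lo [g Dg]]; exists (g^~ k).
have gP A : A \in [set A in D | #|A| == h] ->
  [/\ g A k \in D, #|g A k| = k, g A k \subset A, g (g A k) =1 g A & g A h = A].
  rewrite inE => /andP[/Dg[loA Alo gA gP] /eqP Ah]; move: loA Alo gA; rewrite Ah.
  move=> loA Alo gA; have [||gD gc _ gg gs] := gP k; [lia|lia|].
  by split=> //; rewrite -{2}gA; apply: gs; lia.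
split=> [A B /gP[_ _ _ gA Ah] /gP[_ _ _ gB Bh] eAB|A /gP[]] //.
by rewrite -Ah -Bh -gA -gB eAB.
Qed.

(** * Counting sets by the size of their trace on [X] *)

Lemma card_ksubsets X k : #|ksubsets X k| = 'C(#|X|, k).
Proof. exact: cards_draws. Qed.

Lemma card_ksubsets_meet X i j :
  #|[set A : {set T} | #|A :&: X| == i & #|A| == i + j]|
  = 'C(#|X|, i) * 'C(#|T| - #|X|, j).
Proof.
have <- : #|~: X| = #|T| - #|X| by rewrite -(cardsC X) addKn.
rewrite -!card_ksubsets -cardsX.
rewrite -(card_in_imset (f := fun A => (A :&: X, A :\: X))); last first.
  by move=> A B _ _ [e1 e2]; rewrite -(setID A X) e1 e2 setID.
apply: eq_card => -[P Q]; rewrite !inE /=; apply/imsetP/idP => [[A]|].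
  rewrite inE => /andP[/eqP Ai /eqP Aij] [-> ->].
  rewrite subsetIr Ai eqxx subsetDr /=.
  by have := cardsID X A; lia.
move=> /andP[/andP[PX /eqP Pi] /andP[QX /eqP Qj]].
have PQX : (P :|: Q) :&: X = P.
  rewrite setIUl (setIidPl PX) (_ : Q :&: X = set0) ?setU0 //.
  by apply/eqP; rewrite setI_eq0 disjoints_subset.
have PQD : (P :|: Q) :\: X = Q.
  rewrite setDUl (_ : P :\: X = set0) ?set0U; last by apply/eqP; rewrite setD_eq0.
  by apply/setDidPl; rewrite disjoints_subset.
exists (P :|: Q); rewrite ?PQX ?PQD // inE PQX Pi eqxx /=.
by rewrite -(cardsID X) PQX PQD Pi Qj.
Qed.

Lemma card_ksubsets_meet_gt X s k : s <= k ->
  #|[set A in ksubsets [set: T] k | s < #|A :&: X|]|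
    + \sum_(0 <= i < s.+1) 'C(#|X|, i) * 'C(#|T| - #|X|, k - i)
  = 'C(#|T|, k).
Proof.
move=> sk.
rewrite -{2}cardsT -card_ksubsets -[RHS](cardsID [set A | s < #|A :&: X|]).
congr (_ + _); first by apply: eq_card => A; rewrite !inE.
rewrite big_mkord.
rewrite -[RHS]sum1_card.
(* Only traces of size at most [s] remain here, so [inord] never takes its default value on them. *)
rewrite (partition_big (fun A => inord #|A :&: X| : 'I_s.+1) predT) //=.
apply: eq_bigr => i _; have := ltn_ord i; rewrite ltnS => le_is.
rewrite sum1_card -card_ksubsets_meet subnKC ?(leq_trans le_is) //.
apply: eq_card => A; rewrite [LHS]inE [RHS]unfold_in /= !inE subsetT -leqNgt /=.
case: leqP => h /=; first by rewrite andbC -val_eqE /= inordK.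
by rewrite (_ : (_ == _ :> nat) = false) //; lia.
Qed.

(** Otherwise [X :\: A] has at least [l] points and contains an [l]-set disjoint from [A]. *)
Lemma card_setI_gt_of_meet_ksubsets X A l s : #|X| = l + s ->
  (forall B, B \in ksubsets X l -> 0 < #|A :&: B|) -> s < #|A :&: X|.
Proof.
move=> cX meetA; rewrite ltnNge; apply/negP => le_s.
have : 0 < #|ksubsets (X :\: A) l|.
  by rewrite card_ksubsets bin_gt0; have := cardsID A X; rewrite setIC; lia.
case/card_gt0P=> B; rewrite inE => /andP[BXA cB].
have := meetA B; rewrite inE cB (subset_trans BXA (subsetDl _ _)) => /(_ isT).
by rewrite lt0n cards_eq0 setIC setI_eq0 disjoints_subset => /negP;
   apply; apply: subset_trans BXA _; rewrite setDE subsetIr.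
Qed.

End SetFamilies.

(** * The bound for the two families *)

Lemma card_initseg n m : m <= n -> #|initseg n m| = m.
Proof.
move=> mn; rewrite -sum1_card (eq_bigl (fun i : 'I_n => i < m)) => [|i].
  by rewrite -(big_ord_widen n (fun=> 1) mn) sum1_card card_ord.
by rewrite inE.
Qed.

Theorem theorem2p2 (n k l s : nat)
    (hls : s + 1 <= l) (hkl : l <= k) (hn : k + l <= n)
    (F G : {set {set 'I_n}})
    (hF : F \subset ksubsets [set: 'I_n] k)
    (hG : G \subset ksubsets [set: 'I_n] l)
    (hFG : cross_intersecting F G)
    (hGint : intersecting G)
    (hGsub : ksubsets (initseg n (l + s)) l \subset G) :
  ((#|F|%:Z + #|G|%:Z)
    <= 'C(l + s, l)%:Z + 'C(n, k)%:Z
       - \sum_(0 <= i < s.+1) 'C(l + s, i)%:Z * 'C(n - l - s, k - i)%:Z)%R.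
Proof.
pose X := initseg n (l + s); pose F0 := [set A in ksubsets setT k | s < #|A :&: X|].
have cX : #|X| = l + s by apply: card_initseg; lia.
pose G' := G :\: ksubsets X l.
have cG : #|G| = 'C(l + s, l) + #|G'|.
  by rewrite -(cardsID (ksubsets X l) G) (setIidPr hGsub) card_ksubsets cX.
have FF0 : F \subset F0.
  apply/subsetP => A AF; rewrite inE (subsetP hF _ AF) /=.
  apply: card_setI_gt_of_meet_ksubsets cX _ => B BX.
  exact: hFG AF (subsetP hGsub _ BX).
(* As [#|X| = l + s], the second bound means [#|A :&: X| < l]; the pair of bounds is invariant under
   complementation of [A]. *)
pose P := [set A : {set 'I_n} | s.+1 <= #|A :&: X| & #|A :&: X| + s.+1 <= #|X|].
have G'P B : B \in G' -> ~: B \in [set A in P | #|A| == n - l].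
  rewrite !inE => /andP[BX BG].
  have /andP[_ /eqP cB] : (B \subset setT) && (#|B| == l).
    by have := subsetP hG _ BG; rewrite inE.
  have sB : s < #|B :&: X|.
    apply: card_setI_gt_of_meet_ksubsets cX _ => C CX.
    exact: hGint BG (subsetP hGsub _ CX).
  (* Equality would put [B] inside [X], among the sets removed from [G]. *)
  have lB : #|B :&: X| < l.
    have : #|B :&: X| != #|B|.
      apply: contra BX => /eqP e; rewrite cB eqxx andbT.
      by apply/setIidPl/eqP; rewrite eqEcard subsetIl e leqnn.
    by have := subset_leq_card (subsetIl B X); lia.
  have := cardsID B X; have := cardsC B; rewrite card_ord setDE setIC (setIC X).
  by lia.
have [|||phi [phi_inj phiP]] := @symmetric_chains_inj _ P n (n - l) k.
- by lia.
- by lia.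
- by have := has_symmetric_chains_band X s.+1; rewrite card_ord.
pose psi B := phi (~: B).
have cpsi : #|psi @: G'| = #|G'|.
  apply: card_in_imset => B C BG CG e; apply: setC_inj.
  exact: phi_inj (G'P _ BG) (G'P _ CG) e.
have psiF : [disjoint F & psi @: G'].
  rewrite disjoint_sym disjoints_subset; apply/subsetP=> _ /imsetP[B BG ->].
  have [_ _ sub] := phiP _ (G'P _ BG); rewrite inE; apply/negP => psF.
  have /hFG/(_ _) := psF; move: BG; rewrite inE => /andP[_ BG] /(_ _ BG).
  by rewrite lt0n cards_eq0 setI_eq0 disjoints_subset sub.
have psiF0 : psi @: G' \subset F0.
  apply/subsetP=> _ /imsetP[B BG ->]; have [] := phiP _ (G'P _ BG).
  by rewrite !inE subsetT => /andP[-> _] ->; rewrite eqxx.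
have le0 : #|F| + #|G'| <= #|F0|.
  rewrite -cpsi; have [_] := leq_card_setU F (psi @: G').
  rewrite psiF => /eqP <-; apply: subset_leq_card.
  by rewrite subUset FF0.
have := card_ksubsets_meet_gt X (s := s) (k := k); rewrite -/F0 cX card_ord.
move=> /(_ ltac:(lia)) e0.
(* Once the integer sum is the cast of the natural one, the bound follows linearly from [cG], [le0]
   and [e0]. *)
have -> : (\sum_(0 <= i < s.+1) 'C(l + s, i)%:Z * 'C(n - l - s, k - i)%:Z =
   (\sum_(0 <= i < s.+1) 'C(l + s, i) * 'C(n - (l + s), k - i))%N%:Z)%R.
  rewrite (big_morph Posz PoszD (erefl _)); apply: eq_bigr => i _.
  by rewrite PoszM subnDA.
by lia.
Qed.
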